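(* Let $F$ be a free group of finite rank and let $R$ be a normal subgroup of $F$ which is generated as a normal subgroup by a finite set. Let $x_1,\dots,x_n$ be a free basis of $F$ and let $w_1,\dots,w_t,w_{t+1},\dots$ (a finite or infinite sequence) be a free basis of $R$ such that $0\le t\le n$, $w_i\equiv x_i^{\alpha_i}\bmod F'$ with $\alpha_i$ a nonzero integer for $1\le i\le t$, and $w_j\in F'$ for $j>t$. Put $W_1=\{w_1,\dots,w_t\}$, $W_2=\{w_{t+1},w_{t+2},\dots\}$ and let $U_1=U(W_1,W_2)$ be the set obtained from $W_1\cup W_2$ by the $U$-construction. Then $R\cap\gamma_2(F)$ has free generating set $W_2\cup U_1$, and $R'$ has free generating set $U_1\cup U$, where $U=U(W_2,U_1)$ is the set obtained from $W_2\cup U_1$ by the $U$-construction.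
   Context: $\gamma_2(F)=F'$ and $R'$ denote derived groups. Commutators: $[x,y]=x^{-1}y^{-1}xy$, and longer commutators are left-normed, $[x_1,\dots,x_{k+1}]=[[x_1,\dots,x_k],x_{k+1}]$. $U$-construction: let $A,B$ be disjoint subsets of a group with $A\cup B$ totally ordered so that every member of $A$ precedes every member of $B$. Then $U(A,B)$ is the set of all elements $$[b^{\beta},a_1^{\alpha_1},a_2^{\alpha_2},\dots,a_q^{\alpha_q}]$$ with $q\ge 1$, $b\in A\cup B$, $a_i\in A$, $\beta,\alpha_i\in\{+1,-1\}$, $b>a_1\le a_2\le\dots\le a_q$, $\beta=+1$ whenever $b\in B$, and the indices being index coherent: whenever two of the elements $b,a_1,\dots,a_q$ are equal, their exponents are equal. In $U(W_1,W_2)$ the role of $A$ is played by $W_1$ and that of $B$ by $W_2$; in $U(W_2,U_1)$ the role of $A$ is played by $W_2$ and that of $B$ by $U_1$; the unions carry any total orders in which the members of the first set precede those of the second. *)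

(* Defs.v *)
From mathcomp Require Export all_boot all_order ssrint.
From mathcomp Require Export boolp classical_sets functions cardinality.

Set Implicit Arguments.
Unset Strict Implicit.
Unset Printing Implicit Defensive.

Local Open Scope classical_set_scope.
Local Open Scope group_scope.

Section Subgroups.
Variable G : groupType.
Implicit Types (H X : set G) (x g : G).

Definition subgroup H : Prop :=
  H 1 /\ forall g h, H g -> H h -> H (g / h).

Definition normal_subgroup H : Prop :=
  subgroup H /\ forall h g, H h -> H (h ^ g).

Definition generated X : set G := smallest subgroup X.

Definition normal_closure X : set G := smallest normal_subgroup X.

Definition derived H : set G :=
  generated [set c | exists g h, [/\ H g, H h & c = [~ g, h]]].

Definition zpow x (k : int) : G :=
  match k with Posz m => x ^+ m | Negz m => x ^- m.+1 end.

End Subgroups.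

Section FreeBases.
Variable G : groupType.
Implicit Types (H X : set G).

(* The pair (g, false) stands for g^+1 and (g, true) for g^-1. *)
Definition letter_val (p : G * bool) : G := if p.2 then p.1^-1 else p.1.

Definition reduced (s : seq (G * bool)) : bool :=
  sorted (fun p q => ~~ ((p.1 == q.1) && (p.2 != q.2))) s.

Definition free_basis X H : Prop :=
  generated X = H /\
  forall s : seq (G * bool),
    (forall p, p \in s -> X p.1) -> s <> [::] -> reduced s ->
    \prod_(p <- s) letter_val p <> 1.

Definition free_basis_family (I : Type) (D : set I) (f : I -> G) H : Prop :=
  set_inj D f /\ free_basis (f @` D) H.

End FreeBases.

(* Index set of a sequence with m terms (Some m) or infinitely many (None). *)
Definition seq_index (N : option nat) : set nat :=
  if N is Some m then `I_m else [set: nat].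

Section UConstruction.
Variable G : groupType.
Implicit Types (A B : set G) (le : rel G).

Definition total_order_on (D : set G) le : Prop :=
  [/\ {in D, reflexive le}, {in D &, antisymmetric le},
      {in D & &, transitive le} & {in D &, total le}].

Definition precedes le (g h : G) : bool := le g h && (g != h).

(* The strictness of [precedes] forces A and B to be disjoint. *)
Definition U_order A B le : Prop :=
  total_order_on (A `|` B) le /\
  forall a b, A a -> B b -> precedes le a b.

(* b :: a :: s lists the letters b^beta, a_1^alpha_1, ..., a_q^alpha_q. *)
Definition Uset le A B : set G :=
  [set g | exists (b a : G * bool) (s : seq (G * bool)),
    [/\ (A `|` B) b.1,
        (forall p, p \in a :: s -> A p.1),
        precedes le a.1 b.1,
        sorted le [seq p.1 | p <- a :: s]
      & [/\ (B b.1 -> b.2 = false),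
            (forall p q, p \in b :: a :: s -> q \in b :: a :: s ->
               p.1 = q.1 -> p.2 = q.2)
          & g = foldl (fun u p => [~ u, letter_val p])
                      (letter_val b) (a :: s)]]].

End UConstruction.

(* Main.v *)
From HB Require Import structures.
From mathcomp Require Import ssralg ssrnum zify.
Require Import Defs.

Set Implicit Arguments.
Unset Strict Implicit.
Unset Printing Implicit Defensive.

Import GRing.Theory Num.Theory.
Local Open Scope classical_set_scope.
Local Open Scope group_scope.

(** Both assertions are instances of one fact, [commutator_free_basis]: if a group
    [H] is free on the disjoint union of [A] and [B], then the kernel of the map
    from [H] to the free abelian group on [A] that forgets [B] is free on [B]
    together with [U(A,B)]. For the first one, [R] is free on [W1] and [W2], and the
    congruences for the [w_i] say that an element of [R] lies in the derived group
    of [F] exactly when its exponents in [w_1, ..., w_t] vanish. For the second one,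
    the kernel so obtained is free on [W2] and [U1], so the fact applies to it, and its
    elements whose exponents in [W2] vanish too form the derived group of [R]; this
    last point follows again from [commutator_free_basis], with all of the basis in
    the role of [A], as it produces a generating set of commutators.

    The fact itself is proved on the Cayley graph of the free abelian group [Z^A], on
    which [H] acts with [B] acting trivially. A labelling of the edges by a group [L]
    is the same as a cocycle [Phi g q], the label of the path [g] from [q]
    ([free_basis_cocycle]). The edge [x] at [q] is a tree edge when [q] has no
    coordinate below [x] ([low x q]). These edges form a spanning tree, and we only
    consider labellings that are trivial on it. Because the letters [a_1, ..., a_q]
    of a commutator in [U(A,B)] are sorted, they run along tree edges only in its
    path from the origin. Hence commutation with [a] becomes the operator
    [h(q) |-> h(q)^-1 h(q - a)] on labels ([shifted_comm]), where [h] is the label of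
    the first entry [b^beta].

    Such a difference equation is solved by reading it backwards
    ([shifted_split]): [h(q - a) = h(q) (Dh)(q)]. So the values at the origin of all
    iterated differences of [h] along sorted words determine [h], and may be
    prescribed at will. For [b] in [A], the edges of direction [b] are split between
    [b] and [b^-1] according to the sign of their coordinate in direction [b]; index
    coherence keeps the path of a commutator on one side, so every edge outside the
    tree is prescribed exactly once.
    Prescribing the values gives freeness ([Phi_basis]): there is a labelling with
    [Phi v 0 = f v] for arbitrary [f], in particular with values in a free group.
    Determining them gives generation ([Phi_mem]): apply it to the cocycle of
    Schreier generators, for which [Phi g 0 = g] on the kernel. *)

(** * Subgroups and words *)

Section GeneratedSubgroups.
Variable G : groupType.
Implicit Types (H K X : set G) (g h x : G) (p : G * bool) (s : seq (G * bool)).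

Lemma subgroupV H g : subgroup H -> H g -> H g^-1.
Proof. by move=> [H1 HD] Hg; rewrite -div1g; apply: HD. Qed.

Lemma subgroupM H g h : subgroup H -> H g -> H h -> H (g * h).
Proof.
move=> sH Hg Hh; rewrite -[h]invgK.
by apply: sH.2 => //; apply: subgroupV.
Qed.

Lemma subgroupR H g h : subgroup H -> H g -> H h -> H [~ g, h].
Proof.
move=> sH Hg Hh.
have [Vg Vh] : H g^-1 /\ H h^-1 by split; apply: subgroupV.
by rewrite commgEl conjgE; do ?apply: subgroupM.
Qed.

Lemma subgroup_letter H p : subgroup H -> H p.1 -> H (letter_val p).
Proof. by rewrite /letter_val => sH Hp; case: p.2 => //; apply: subgroupV. Qed.

Lemma generated_subgroup X : subgroup (generated X).
Proof.
split=> [K [[K1 _] _] //|g h Xg Xh K KX].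
by case: (KX) => [[_ KD] _]; apply: KD; [apply: Xg | apply: Xh].
Qed.

Lemma sub_generated X : X `<=` generated X.
Proof. by move=> x Xx K [_]; apply. Qed.

Lemma generated_min X K : subgroup K -> X `<=` K -> generated X `<=` K.
Proof. by move=> sK XK g; apply. Qed.

Lemma derived_sub H : subgroup H -> derived H `<=` H.
Proof.
by move=> sH; apply: generated_min => // _ [g [h [Hg Hh ->]]]; apply: subgroupR.
Qed.

Lemma derivedS H K : H `<=` K -> derived H `<=` derived K.
Proof.
move=> HK; apply: generated_min; first exact: generated_subgroup.
move=> _ [g [h [Hg Hh ->]]]; apply: sub_generated.
by exists g, h; split=> //; apply: HK.
Qed.

Lemma derivedR H g h : H g -> H h -> derived H [~ g, h].
Proof. by move=> Hg Hh; apply: sub_generated; exists g, h. Qed.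

Definition flip p := (p.1, ~~ p.2).

Lemma flipK : involutive flip.
Proof. by case=> x b; rewrite /flip negbK. Qed.

Lemma letter_flip p : letter_val (flip p) = (letter_val p)^-1.
Proof. by case: p => x [] //=; rewrite /letter_val /= invgK. Qed.

Definition word_inv s := rev (map flip s).

Lemma word_inv_letters X s :
  (forall p, p \in s -> X p.1) -> forall p, p \in word_inv s -> X p.1.
Proof.
by move=> Xs p; rewrite mem_rev => /mapP[q qs ->]; apply: (Xs q).
Qed.

Lemma prod_word_inv (L : groupType) (v : G * bool -> L) s :
  (forall p, v (flip p) = (v p)^-1) ->
  \prod_(p <- word_inv s) v p = (\prod_(p <- s) v p)^-1.
Proof.
move=> vV; elim: s => [|p s IHs]; first by rewrite !big_nil invg1.
rewrite /word_inv /= rev_cons -cats1 big_cat big_seq1 vV big_cons invgM.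
by congr (_ * _).
Qed.

Lemma generated_word X g : generated X g ->
  exists2 s, (forall p, p \in s -> X p.1) & g = \prod_(p <- s) letter_val p.
Proof.
pose K : set G := [set g | exists2 s, (forall p, p \in s -> X p.1)
                                 & g = \prod_(p <- s) letter_val p].
have sK : subgroup K.
  split=> [|_ _ [s Xs ->] [r Xr ->]]; first by exists [::]; rewrite ?big_nil.
  exists (s ++ word_inv r) => [p|].
    by rewrite mem_cat => /orP[/Xs//|]; apply: word_inv_letters.
  by rewrite big_cat prod_word_inv//; apply: letter_flip.
apply: (generated_min sK) => x Xx; exists [:: (x, false)].
  by move=> p /[!inE] /eqP->.
by rewrite big_seq1.
Qed.

Lemma reduced_or_cancel s :
  reduced s \/ exists s1 p s2, s = s1 ++ p :: flip p :: s2.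
Proof.
elim: s => [|p s [rs|[s1 [q [s2 ->]]]]]; first by left.
- case: s rs => [|q s] rs; first by left.
  case E : ((p.1 == q.1) && (p.2 != q.2)); last by left; rewrite /reduced /= E.
  right; exists [::], p, s; congr (_ :: _ :: _).
  case: p q E {rs} => x a [y b] /= /andP[/eqP-> ab].
  by rewrite /flip /=; congr (_, _); case: a b ab => -[].
- by right; exists (p :: s1), q, s2.
Qed.

End GeneratedSubgroups.

(** * The universal property of free bases *)

Section UniversalProperty.
Variables (G : groupType) (X H : set G) (hX : free_basis X H).

Lemma free_basis_subgroup : subgroup H.
Proof. by rewrite -hX.1; apply: generated_subgroup. Qed.

Lemma free_basis_sub : X `<=` H.
Proof. by rewrite -hX.1; apply: sub_generated. Qed.

Lemma free_basis_ind (K : set G) : subgroup K -> X `<=` K -> H `<=` K.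
Proof. by move=> sK XK; rewrite -hX.1; apply: generated_min. Qed.

(** A trivial word over a free basis is not reduced, hence contains a cancelling
    pair; removing it leaves a shorter trivial word, which has the same value
    under any other letter assignment. *)
Lemma trivial_word_image (L : groupType) (v : G * bool -> L) s :
    (forall p, v (flip p) = (v p)^-1) ->
    (forall p, p \in s -> X p.1) -> \prod_(p <- s) letter_val p = 1 ->
  \prod_(p <- s) v p = 1.
Proof.
move=> vV; have [n] := ubnP (size s); elim: n s => // n IHn s sz_s Xs s1.
have [rs|[s' [p [r Es]]]] := reduced_or_cancel s.
  case: s {IHn sz_s} Xs s1 rs => [|p s] Xs s1 rs; first by rewrite big_nil.
  by have := hX.2 _ Xs _ rs s1; case.
have drop_pair (M : groupType) (u : G * bool -> M) :
    (forall p, u (flip p) = (u p)^-1) ->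
    \prod_(p <- s) u p = \prod_(p <- s' ++ r) u p.
  by move=> uV; rewrite Es !big_cat !big_cons uV /=; rewrite mulVKg.
rewrite drop_pair//; apply: IHn.
- by move: sz_s; rewrite Es !size_cat /=; lia.
- move=> q qs; apply: Xs; rewrite Es mem_cat !inE.
  by move: qs; rewrite mem_cat => /orP[]->; rewrite ?orbT.
- by rewrite -drop_pair//; apply: letter_flip.
Qed.

(** The value of a word under [f] depends on its product only, because the word
    formed by one word and the inverse of another is trivial. *)
Lemma free_basis_extend (L : groupType) (f : G -> L) :
  exists phi : G -> L, (forall g h, H g -> H h -> phi (g * h) = phi g * phi h)
                    /\ (forall x, X x -> phi x = f x).
Proof.
pose v (p : G * bool) := if p.2 then (f p.1)^-1 else f p.1.
have vV p : v (flip p) = (v p)^-1.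
  by case: p => x [] //=; rewrite /v /= invgK.
pose wordof g s := (forall p, p \in s -> X p.1) /\
                   g = \prod_(p <- s) letter_val p.
have val_uniq g s r : wordof g s -> wordof g r ->
    \prod_(p <- s) v p = \prod_(p <- r) v p.
  move=> [Xs gs] [Xr gr]; apply: divg1_eq.
  rewrite -prod_word_inv// -big_cat; apply: trivial_word_image => //.
    move=> p; rewrite mem_cat => /orP[/Xs//|]; exact: word_inv_letters.
  rewrite big_cat /= prod_word_inv; last exact: letter_flip.
  by rewrite -gs -gr mulgV.
pose w g := xget [::] (wordof g).
have wP g : H g -> wordof g (w g).
  rewrite -hX.1 => /generated_word[s Xs gs].
  by rewrite /w; case: xgetP => [? -> //|/(_ s)[]].
exists (fun g => \prod_(p <- w g) v p); split=> [g h Hg Hh|x Xx].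
  have [[Xg eg] [Xh eh]] := (wP g Hg, wP h Hh).
  rewrite -big_cat; apply: (@val_uniq (g * h)).
    exact/wP/(subgroupM free_basis_subgroup).
  split; first by move=> p; rewrite mem_cat => /orP[/Xg|/Xh].
  by rewrite big_cat -eg -eh.
rewrite (val_uniq x _ [:: (x, false)]) ?big_seq1//.
  exact/wP/free_basis_sub.
by split; [move=> p /[!inE]/eqP->|rewrite big_seq1].
Qed.

End UniversalProperty.

(** * A free group acting on reduced words *)

Section Bijections.
Variable T : Type.

(** The product applies its left factor first, so that words act letter by letter
    from left to right. *)
Record bij := Bij { fwd : T -> T; bwd : T -> T;
                    fwdK : cancel fwd bwd; bwdK : cancel bwd fwd }.

Lemma bij_eq (f g : bij) : fwd f = fwd g -> f = g.
Proof.
case: f g => f f' fK f'K [g g' gK g'K] /= fg; subst g.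
have Eg : f' = g' by apply/funext => x; rewrite -{1}(g'K x) fK.
by subst g'; congr Bij; apply: Prop_irrelevance.
Qed.

HB.instance Definition _ := gen_eqMixin bij.
HB.instance Definition _ := gen_choiceMixin bij.

Definition bij_one := @Bij id id (fun=> erefl) (fun=> erefl).
Definition bij_inv f := Bij (bwdK f) (fwdK f).
Definition bij_mul f g := Bij (can_comp (fwdK g) (fwdK f))
                              (can_comp (bwdK f) (bwdK g)).

Fact bij_mulA : associative bij_mul. Proof. by move=> *; apply: bij_eq. Qed.
Fact bij_mul1 : left_id bij_one bij_mul. Proof. by move=> *; apply: bij_eq. Qed.
Fact bij_mulr1 : right_id bij_one bij_mul. Proof. by move=> *; apply: bij_eq. Qed.
Fact bij_mulV : left_inverse bij_one bij_inv bij_mul.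
Proof. by move=> f; apply/bij_eq/funext => x /=; rewrite bwdK. Qed.
Fact bij_mulrV : right_inverse bij_one bij_inv bij_mul.
Proof. by move=> f; apply/bij_eq/funext => x /=; rewrite fwdK. Qed.

HB.instance Definition _ :=
  isGroup.Build bij bij_mulA bij_mul1 bij_mulr1 bij_mulV bij_mulrV.

End Bijections.

Local Arguments reduced : simpl never.

Section FreeLetters.
Variable G : groupType.
Implicit Types (p : G * bool) (s : seq (G * bool)).

Definition push p s := if s is q :: s' then if q == flip p then s' else p :: s
                       else [:: p].

Lemma reduced_cons p q s :
  reduced (p :: q :: s) = (q != flip p) && reduced (q :: s).
Proof.
rewrite /reduced /=; congr (~~ _ && _).
case: p q => x a [y b] /=; rewrite /flip xpair_eqE /= [y == x]eq_sym.
by case: a b => -[].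
Qed.

Lemma reduced_push p s : reduced s -> reduced (push p s).
Proof.
case: s => [|q s] //=; case: eqP => [_|/eqP np] rs; first exact: path_sorted rs.
by rewrite reduced_cons np.
Qed.

Lemma pushK p s : reduced s -> push (flip p) (push p s) = s.
Proof.
case: s => [|q s] /=; first by rewrite flipK eqxx.
case: eqP => [-> |_ _] /=; last by rewrite flipK eqxx.
case: s => [|q' s] //; rewrite reduced_cons => /andP[nq _] /=.
by rewrite (negPf nq).
Qed.

Let T := {s : seq (G * bool) | reduced s}.
Let pushT p (t : T) : T := 
  exist (fun s => reduced s) (push p (val t)) (reduced_push p (valP t)).

Let pushTK p : cancel (pushT p) (pushT (flip p)).
Proof. by move=> t; apply/val_inj/pushK/(valP t). Qed.

Let pushTVK p : cancel (pushT (flip p)) (pushT p).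
Proof. by have := @pushTK (flip p); rewrite flipK. Qed.

(** Van der Waerden's permutations: letters act on reduced words by
    concatenation followed by cancellation. *)
Definition letter_perm (g : G) : bij T :=
  Bij (pushTK (g, false)) (pushTVK (g, false)).

Lemma letter_perm_word s (t : T) : reduced (catrev s (val t)) ->
  val (fwd (\prod_(p <- s) letter_val (letter_perm p.1, p.2)) t)
    = catrev s (val t).
Proof.
elim: s t => [|p s IHs] t rst; first by rewrite big_nil.
rewrite big_cons /=.
have Ep : val (fwd (letter_val (letter_perm p.1, p.2)) t) = p :: val t.
  transitivity (push p (val t)); first by case: p {rst} => g [].
  case: (val t) rst => [|q s'] //=.
  rewrite catrevE /reduced => /cat_sorted2[_].
  by rewrite -/(reduced _) reduced_cons => /andP[/negPf->].
by rewrite IHs Ep.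
Qed.

(** Every reduced word of length one or more is detected by its action on the
    empty word, so the permutations attached to the elements of [G], taken as
    mere letters, are free generators. *)
Lemma letter_perm_free s : s <> [::] -> reduced s ->
  \prod_(p <- s) letter_val (letter_perm p.1, p.2) <> 1.
Proof.
move=> s_neq0 rs s1.
have nilT : reduced ([::] : seq (G * bool)) by [].
have /= := @letter_perm_word s (exist (fun s => reduced s) [::] nilT); rewrite s1 /= -/(rev s).
have -> : reduced (rev s).
  rewrite /reduced rev_sorted; move: rs; rewrite /reduced.
  by under eq_sorted do rewrite eq_sym [_ == _ :> bool]eq_sym.
by move=> /(_ isT) E; case: s_neq0; rewrite -[s]revK -E.
Qed.

End FreeLetters.

(** * Cocycles *)

Section Wreath.
Variables (P : zmodType) (L : groupType).

(** The unrestricted wreath product, seen as the group of labelled paths: an element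
    moves the point [q] to [q + wshift] and picks up the label [wlabel q] on the way. *)
Record wreath := Wreath { wshift : P; wlabel : P -> L }.

Lemma wreath_eq u v : wshift u = wshift v -> wlabel u =1 wlabel v -> u = v.
Proof. by case: u v => a f [b g] /= -> /funext->. Qed.

HB.instance Definition _ := gen_eqMixin wreath.
HB.instance Definition _ := gen_choiceMixin wreath.

Definition wreath_one := Wreath 0%R (fun=> 1).
Definition wreath_inv u :=
  Wreath (- wshift u)%R (fun q => (wlabel u (q - wshift u)%R)^-1).
Definition wreath_mul u v := Wreath (wshift u + wshift v)%R
  (fun q => wlabel u q * wlabel v (q + wshift u)%R).

Fact wreath_mulA : associative wreath_mul.
Proof.
by move=> u v w; apply: wreath_eq => [|q] /=; rewrite addrA ?mulgA.
Qed.
Fact wreath_mul1 : left_id wreath_one wreath_mul.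
Proof. by move=> u; apply: wreath_eq => [|q] /=; rewrite ?add0r ?mul1g ?addr0. Qed.
Fact wreath_mulr1 : right_id wreath_one wreath_mul.
Proof. by move=> u; apply: wreath_eq => [|q] /=; rewrite ?addr0 ?mulg1. Qed.
Fact wreath_mulV : left_inverse wreath_one wreath_inv wreath_mul.
Proof. by move=> u; apply: wreath_eq => [|q] /=; rewrite ?addNr ?mulVg. Qed.
Fact wreath_mulrV : right_inverse wreath_one wreath_inv wreath_mul.
Proof. by move=> u; apply: wreath_eq => [|q] /=; rewrite ?addrN ?addrK ?mulgV. Qed.

HB.instance Definition _ := isGroup.Build wreath
  wreath_mulA wreath_mul1 wreath_mulr1 wreath_mulV wreath_mulrV.

End Wreath.

Definition additive_on (G : groupType) (P : zmodType) (H : set G) (e : G -> P) :=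
  forall g h, H g -> H h -> e (g * h) = (e g + e h)%R.

Definition cocycle (G L : groupType) (P : zmodType) (H : set G) (e : G -> P)
    (Phi : G -> P -> L) :=
  forall g h, H g -> H h -> forall q, Phi (g * h) q = Phi g q * Phi h (q + e g)%R.

Section Additive.
Variables (G : groupType) (P : zmodType) (H : set G) (e : G -> P).
Hypotheses (sH : subgroup H) (eD : additive_on H e).

Lemma additive_on1 : e 1 = 0%R.
Proof. by apply: (@addrI _ (e 1)); rewrite -eD ?mulg1 ?addr0//; apply: sH.1. Qed.

Lemma additive_onV g : H g -> e g^-1 = (- e g)%R.
Proof.
move=> Hg; have Vg := subgroupV sH Hg.
by apply: (@addrI _ (e g)); rewrite -eD// mulgV additive_on1 addrN.
Qed.

Lemma additive_onR g h : H g -> H h -> e [~ g, h] = 0%R.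
Proof.
move=> Hg Hh; have [Vg Vh] : H g^-1 /\ H h^-1 by split; apply: subgroupV.
have Hgh : H (h^-1 * (g * h)) by do ?apply: subgroupM.
have Hgh' : H (g * h) by do ?apply: subgroupM.
rewrite commgEl conjgE !eD// !additive_onV//.
by rewrite [(- e h + _)%R]addrC addrK addNr.
Qed.

Lemma additive_on_ker : subgroup (H `&` [set g | e g = 0%R]).
Proof.
split=> [|g h [Hg /= eg] [Hh /= eh]]; first by split; [apply: sH.1|apply: additive_on1].
split; first exact: sH.2.
by rewrite /= eD ?additive_onV ?eg ?eh ?subr0//; apply: subgroupV.
Qed.

End Additive.

Lemma additive_on_ext (G : groupType) (P : zmodType) (X H : set G)
    (e e' : G -> P) :
    free_basis X H -> additive_on H e -> additive_on H e' ->
    {in X, e =1 e'} -> {in H, e =1 e'}.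
Proof.
move=> hX eD eD' ee' g /set_mem Hg; have sH := free_basis_subgroup hX.
suff: (H `&` [set g | e g = e' g]) g by case.
apply: (free_basis_ind hX) Hg.
  split=> [|u v [Hu /= eu] [Hv /= ev]].
    by split; [apply: sH.1|rewrite /= (additive_on1 sH)// (additive_on1 sH)].
  have Vv := subgroupV sH Hv.
  split; first exact: sH.2.
  by rewrite /= eD// eD'// (additive_onV sH eD)// (additive_onV sH eD')// eu ev.
by move=> x Xx; split; [apply: free_basis_sub hX _ Xx|apply/ee'/mem_set].
Qed.

(** Extending generators to [wreath P L] prescribes at once the displacement and
    the edge labels of every generator. *)
Lemma free_basis_cocycle (G L : groupType) (P : zmodType) (X H : set G)
    (d : G -> P) (lam : G -> P -> L) : free_basis X H ->
  exists (e : G -> P) (Phi : G -> P -> L),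
    [/\ additive_on H e, cocycle H e Phi, (forall x, X x -> e x = d x)
      & forall x, X x -> Phi x = lam x].
Proof.
move=> hX; have [phi [phiM phiX]] :=
  free_basis_extend hX (fun x => Wreath (d x) (lam x)).
exists (fun g => wshift (phi g)), (fun g => wlabel (phi g)).
split=> [g h Hg Hh|g h Hg Hh q|x Xx|x Xx].
- by rewrite phiM.
- by rewrite phiM.
- by rewrite phiX.
- by rewrite phiX.
Qed.

Lemma sub_minimal_inj (a b c d : nat) : a = 0%N \/ b = 0%N -> c = 0%N \/ d = 0%N ->
  (Posz a - Posz b = Posz c - Posz d)%R -> a = c /\ b = d.
Proof. lia. Qed.

(** * Normal words and the lattice of exponents *)

Section CommutatorBasis.
Variables (G : groupType) (A B H : set G) (le : rel G) (e : G -> G -> int).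
Hypothesis hX : free_basis (A `|` B) H.
Hypothesis hle : U_order A B le.
Hypothesis eD : additive_on H e.
Hypothesis eA : forall a, A a -> e a = fun z => Posz (z == a).
Hypothesis eB : forall b, B b -> e b = 0%R.
Implicit Types (g h u x y z : G) (p a b : G * bool) (s r : seq (G * bool)).

Let sH : subgroup H := free_basis_subgroup hX.

Let H_A x : A x -> H x.
Proof. by move=> Ax; apply: (free_basis_sub hX); left. Qed.

Let H_B x : B x -> H x.
Proof. by move=> Bx; apply: (free_basis_sub hX); right. Qed.

Let H_AB x : (A `|` B) x -> H x. Proof. by case=> [/H_A|/H_B]. Qed.

Lemma order_anti x y : (A `|` B) x -> (A `|` B) y -> le x y -> le y x -> x = y.
Proof.
move=> Dx Dy xy yx; have [[_ anti _ _] _] := hle.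
by apply: (anti x y); rewrite ?xy ?yx//; apply/mem_set.
Qed.

Lemma order_trans x y z :
  (A `|` B) x -> (A `|` B) y -> (A `|` B) z -> le x y -> le y z -> le x z.
Proof.
move=> Dx Dy Dz; have [[_ _ tr _] _] := hle.
by apply: tr; apply/mem_set.
Qed.

Lemma order_leNgt x y : (A `|` B) x -> (A `|` B) y -> ~~ precedes le x y -> le y x.
Proof.
move=> Dx Dy; have [[rfl _ _ tot] _] := hle.
rewrite /precedes negb_and negbK; case/orP => [nxy|/eqP->].
  have := tot x y; rewrite (negPf nxy); apply; exact/mem_set.
exact/rfl/mem_set.
Qed.

Lemma order_ltNge x y : (A `|` B) x -> (A `|` B) y -> precedes le x y -> ~~ le y x.
Proof.
move=> Dx Dy /andP[xy /eqP nxy]; apply/negP => yx; apply: nxy.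
exact: order_anti.
Qed.

Lemma A_notB x : A x -> ~ B x.
Proof. by move=> Ax Bx; have [_ /(_ x x Ax Bx)/andP[_ /eqP]] := hle. Qed.

Definition over s := forall p, p \in s -> A p.1.
Definition coherent s :=
  forall p q, p \in s -> q \in s -> p.1 = q.1 -> p.2 = q.2.
(** Sorted words without cancellation represent the points of the lattice [Z^A]. *)
Definition normal_word s :=
  [/\ over s, sorted le [seq p.1 | p <- s] & coherent s].

Lemma over_cons p s : over (p :: s) <-> A p.1 /\ over s.
Proof.
split=> [Aps|[Ap As] q]; last by rewrite inE => /orP[/eqP->//|/As].
split; first by apply: Aps; rewrite mem_head.
by move=> q qs; apply: Aps; rewrite inE qs orbT.
Qed.

Let trA : {in [pred p : G * bool | p.1 \in A] & &, transitive (relpre fst le)}.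
Proof.
move=> p q r; rewrite !inE /= => Ap Aq Ar.
by apply: order_trans; left.
Qed.

Let all_over s : over s -> all [pred p : G * bool | p.1 \in A] s.
Proof. by move=> As; apply/allP => p /As /mem_set. Qed.

Lemma normal_cons p s : normal_word (p :: s) <->
  [/\ A p.1, normal_word s, (forall q, q \in s -> le p.1 q.1)
    & forall q, q \in s -> q.1 = p.1 -> q.2 = p.2].
Proof.
split=> [[/over_cons[Ap As] sps cps]|[Ap [As ss cs] ps eps]].
  split=> //.
  - split=> //; first exact: path_sorted sps.
    by move=> q r qs rs; apply: cps; rewrite inE ?qs ?rs orbT.
  - move=> q qs; move: sps; rewrite /= path_map => sps.
    have Aps : over (p :: s) by apply/over_cons.
    by have /allP/(_ q qs) := order_path_min_in trA (all_over Aps) sps.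
  - by move=> q qs; apply: cps; rewrite inE ?qs ?eqxx ?orbT.
split; first by apply/over_cons.
  rewrite /= path_map path_min_sorted; first by rewrite -sorted_map.
  by apply/allP => q /ps.
move=> q r; rewrite !inE => /orP[/eqP->|qs] /orP[/eqP->|rs] // E.
- by apply/esym/eps.
- exact: eps.
- exact: cs.
Qed.

Lemma normal_cat s r : normal_word (s ++ r) -> normal_word s /\ normal_word r.
Proof.
elim: s => [|p s IHs] //= /normal_cons[Ap /IHs[ns nr] ps eps].
split=> //; apply/normal_cons; split=> // q qs.
- by apply: ps; rewrite mem_cat qs.
- by apply: eps; rewrite mem_cat qs.
Qed.

Definition disp s : G -> int := (\sum_(p <- s) e (letter_val p))%R.

Lemma disp_nil : disp [::] = 0%R. Proof. exact: big_nil. Qed.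

Lemma disp_cons p s : disp (p :: s) = (e (letter_val p) + disp s)%R.
Proof. exact: big_cons. Qed.

Lemma disp_cat s r : disp (s ++ r) = (disp s + disp r)%R.
Proof. exact: big_cat. Qed.

Let addE (f h : G -> int) z : (f + h)%R z = (f z + h z)%R. Proof. by []. Qed.
Let oppE (f : G -> int) z : (- f)%R z = (- f z)%R. Proof. by []. Qed.

Lemma e_letter p : (A `|` B) p.1 ->
  e (letter_val p) = if p.2 then (- e p.1)%R else e p.1.
Proof.
move=> /H_AB Hp; rewrite /letter_val; case: p.2 => //.
exact: (additive_onV sH).
Qed.

Lemma e_letterA p z : A p.1 ->
  e (letter_val p) z = if z == p.1 then (if p.2 then - Posz 1 else Posz 1)%R else 0%R.
Proof.
move=> Ap; rewrite e_letter; last by left.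
by case: p.2; rewrite ?oppE eA//; case: eqP.
Qed.

Definition mult p s := count_mem p s.

Lemma disp_count s z : over s ->
  disp s z = (Posz (mult (z, false) s) - Posz (mult (z, true) s))%R.
Proof.
elim: s => [|p s IHs]; first by rewrite disp_nil.
move=> /over_cons[Ap /IHs{}IHs]; rewrite disp_cons addE IHs e_letterA// /mult /=.
case: p Ap => x c /= _; rewrite !xpair_eqE [x == z]eq_sym.
by case: eqP; case: c => _ /=; lia.
Qed.

Lemma normal_count s z : normal_word s ->
  mult (z, false) s = 0%N \/ mult (z, true) s = 0%N.
Proof.
move=> [_ _ cs].
case: (boolP ((z, false) \in s)) => [zs|/count_memPn]; last by left.
right; apply/count_memPn/negP => zs'.
by have := cs _ _ zs zs' erefl.
Qed.

Lemma disp_notin s z : over s -> (forall p, p \in s -> p.1 <> z) -> disp s z = 0%R.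
Proof.
move=> As zs; rewrite disp_count//.
have c0 c : mult (z, c) s = 0%N by apply/count_memPn/negP => /zs.
by rewrite !c0.
Qed.

Lemma normal_sign s p : normal_word s -> p \in s ->
  if p.2 then (disp s p.1 < 0)%R else (0 < disp s p.1)%R.
Proof.
move=> ns; have [As _ _] := ns; rewrite disp_count//.
have := normal_count p.1 ns.
rewrite -has_pred1 has_count -/(mult p s).
by case: p => x [] /=; lia.
Qed.

(** The exponents determine the number of occurrences of every signed letter, and
    sortedness determines their order. *)
Lemma normal_disp_inj s r : normal_word s -> normal_word r ->
  disp s = disp r -> s = r.
Proof.
move=> ns nr E; have [[As ss cs] [Ar sr cr]] := (ns, nr).
have Esr : perm_eq s r.
  apply/allP => -[z c] _; apply/eqP.
  change (mult (z, c) s = mult (z, c) r).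
  have {}E : (Posz (mult (z, false) s) - Posz (mult (z, true) s) =
              Posz (mult (z, false) r) - Posz (mult (z, true) r))%R.
    by rewrite -!disp_count// E.
  by case: c; have [] := sub_minimal_inj (normal_count z ns) (normal_count z nr) E.
rewrite !sorted_map in ss sr; apply: (sorted_eq_in _ _ ss sr Esr).
  by move=> p q t /As Ap /As Aq /As At; apply: order_trans; left.
move=> p q sp sq /andP[/= pq qp].
have Epq : p.1 = q.1 by apply: order_anti => //; left; apply: As.
by have := cs _ _ sp sq Epq; case: p q Epq {sp sq pq qp} => ? ? [? ?] /= -> ->.
Qed.

(** Letters commute as far as displacements are concerned, so opposite pairs can be
    removed and the rest sorted. *)
Lemma normal_word_ex s : over s -> exists2 r, normal_word r & disp r = disp s.
Proof.
have [n] := ubnP (size s); elim: n s => // n IHn s sz_s As.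
have [cs|ncs] := pselect (coherent s).
  exists (sort (relpre fst le) s); last by apply: perm_big; rewrite perm_sort.
  split=> [p|| p q]; rewrite ?mem_sort; [exact: As| |exact: cs].
  rewrite sorted_map.
  apply: (@sort_sorted_in _ [pred p : G * bool | p.1 \in A]); last exact: all_over.
  move=> p q /set_mem Ap /set_mem Aq; have [[_ _ _ tot] _] := hle.
  by apply: tot; apply/mem_set; left.
have [p [ps fps]] : exists p, p \in s /\ flip p \in s.
  apply: contra_notP ncs => nps p q ps qs Epq; apply: contra_notP nps => npq.
  exists p; split=> //; suff -> : flip p = q by [].
  case: p q Epq npq {ps qs} => x c [y d] /= -> /eqP cd.
  by rewrite /flip /=; congr (_, _); case: c d cd => -[].
have [s' Es] : exists s', perm_eq s (p :: flip p :: s').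
  exists (rem (flip p) (rem p s)).
  rewrite (perm_trans (perm_to_rem ps))// perm_cons perm_to_rem//.
  have: flip p \in p :: rem p s by rewrite -(perm_mem (perm_to_rem ps)).
  by rewrite inE => /orP[/eqP|//]; case: p {ps fps} => x [].
have As' : over s'.
  by move=> q qs'; apply: As; rewrite (perm_mem Es) !inE qs' !orbT.
have sz_s' : (size s' < n)%N by move: sz_s; rewrite (perm_size Es) /=; lia.
have [r nr Er] := IHn _ sz_s' As'; exists r => //.
have Hp : H (letter_val p) by apply/(subgroup_letter sH)/H_A/As.
rewrite Er /disp (perm_big _ Es) /= !big_cons letter_flip.
by rewrite (additive_onV sH)// addrA addrN add0r.
Qed.

Definition lattice (q : G -> int) := exists2 s, over s & disp s = q.

Lemma lattice0 : lattice 0%R.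
Proof. by exists [::]; rewrite ?disp_nil. Qed.

Lemma latticeD q q' : lattice q -> lattice q' -> lattice (q + q')%R.
Proof.
move=> [s As <-] [r Ar <-]; exists (s ++ r); last exact: disp_cat.
by move=> p; rewrite mem_cat => /orP[/As|/Ar].
Qed.

Lemma latticeN q : lattice q -> lattice (- q)%R.
Proof.
move=> [s As <-]; exists (word_inv s); first exact: word_inv_letters.
elim: s As => [|p s IHs]; first by rewrite /word_inv disp_nil oppr0.
move=> /over_cons[Ap /IHs{}IHs]; rewrite /word_inv /= rev_cons -cats1 disp_cat.
have Hp : H (letter_val p) by apply/(subgroup_letter sH)/H_A.
rewrite -/(word_inv s) IHs !disp_cons disp_nil letter_flip (additive_onV sH)//.
by rewrite addr0 opprD addrC.
Qed.

Lemma lattice_e h : H h -> lattice (e h).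
Proof.
move=> Hh; suff: (H `&` [set g | lattice (e g)]) h by case.
apply: (free_basis_ind hX) Hh.
  split=> [|u v [Hu /= lu] [Hv /= lv]].
    by split; [exact: sH.1|rewrite /= (additive_on1 sH)//; apply: lattice0].
  split; first exact: sH.2.
  rewrite /= eD ?(additive_onV sH)//; last exact: (subgroupV sH).
  by apply: latticeD => //; apply: latticeN.
move=> x Xx; split; first exact: H_AB.
case: Xx => [Ax|Bx] /=; last by rewrite eB//; apply: lattice0.
exists [:: (x, false)]; first by move=> p /[!inE]/eqP->.
by rewrite /disp big_seq1.
Qed.

(** Off the lattice this is the empty word; labels defined through it are then trivial
    on the tree edges there as well. *)
Definition nword (q : G -> int) := xget [::] [set r | normal_word r /\ disp r = q].

Lemma nword_normal q : normal_word (nword q).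
Proof. by rewrite /nword; case: xgetP => [r _ []|]. Qed.

Lemma nword_disp q : lattice q -> disp (nword q) = q.
Proof.
move=> [s /normal_word_ex[r nr <-] <-].
by rewrite /nword; case: xgetP => [t _ []//|/(_ r)[]].
Qed.

Lemma disp_nwordK r : normal_word r -> nword (disp r) = r.
Proof.
move=> nr; apply: normal_disp_inj => //; first exact: nword_normal.
by apply: nword_disp; exists r => //; case: nr.
Qed.

Lemma nword_support q p : p \in nword q -> q p.1 <> 0%R.
Proof.
move=> pq; have Eq : disp (nword q) = q.
  by move: pq; rewrite /nword; case: xgetP => [r _ []|].
have := normal_sign (nword_normal q) pq; rewrite Eq.
by case: p.2; lia.
Qed.

(** The edge [x] at [q] belongs to the spanning tree. *)
Definition low x (q : G -> int) := forall z, A z -> precedes le z x -> q z = 0%R.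

Lemma lowD x q q' : low x q -> low x q' -> low x (q + q')%R.
Proof. by move=> lq lq' z Az zx; rewrite addE lq ?lq'. Qed.

Lemma lowN x q : low x q -> low x (- q)%R.
Proof. by move=> lq z Az zx; rewrite oppE lq. Qed.

Lemma low_e x p : A x -> (A `|` B) p.1 -> le x p.1 -> low x (e (letter_val p)).
Proof.
move=> Ax Dp xp z Az zx.
have [Ap|Bp] := Dp; last by rewrite e_letter// eB//; case: p.2; rewrite ?oppr0.
rewrite e_letterA//; case: eqP => // E; subst z.
by have := order_ltNge Dp (or_introl Ax) zx; rewrite xp.
Qed.

Lemma low_disp x r : A x -> over r -> (forall p, p \in r -> le x p.1) ->
  low x (disp r).
Proof.
move=> Ax Ar xr z Az zx; apply: disp_notin => // p pr E.
have := order_ltNge (or_introl Az) (or_introl Ax) zx.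
by rewrite -E xr.
Qed.

(** * Labels of iterated commutators *)

Definition comms b s := foldl (fun u p => [~ u, letter_val p]) (letter_val b) s.

(** The conditions on an element of [U(A,B)], except that [s] may be empty and that
    [b] need not exceed its head, which is the separate condition [below]. Solving the
    difference equation passes through such words as well. *)
Definition legal b s := [/\ (A `|` B) b.1, (B b.1 -> b.2 = false), normal_word s
                          & forall p, p \in s -> p.1 = b.1 -> p.2 = b.2].
Definition below b s := if s is a :: _ then precedes le a.1 b.1 else true.

Lemma legal_drop b s a r : legal b (s ++ a :: r) -> legal b (s ++ r).
Proof.
move=> [Db Bb nsr csr]; split=> //.
  elim: (s) nsr => [|p s' IHs]; first by case/normal_cons.
  move=> /normal_cons[Ap /IHs ns ps eps]; apply/normal_cons; split=> // q.
    by rewrite mem_cat => qs; apply: ps; rewrite mem_cat inE orbCA qs orbT.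
  by rewrite mem_cat => qs; apply: eps; rewrite mem_cat inE orbCA qs orbT.
by move=> p; rewrite mem_cat => ps; apply: csr; rewrite mem_cat inE orbCA ps orbT.
Qed.

Lemma Uset_comms v : Uset le A B v <->
  exists b s, [/\ s <> [::], legal b s, below b s & v = comms b s].
Proof.
split=> [[b [a [s [Db As ab ss [Bb cs ->]]]]]|[b [[|a s] [// _ []]]]].
  exists b, (a :: s); split=> //; split=> //.
    split=> // p q ps qs; apply: cs; rewrite inE ?ps ?qs orbT//.
  by move=> p ps Epb; apply: cs; rewrite ?mem_head // inE ps orbT.
move=> Db Bb [As ss cs] csb ab ->; exists b, a, s; split=> //; split=> // p q.
rewrite inE => /orP[/eqP->|ps]; rewrite inE => /orP[/eqP->|qs] E //.
- by apply/esym/csb.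
- exact: csb.
- exact: cs.
Qed.

Lemma comms_rcons b s a : comms b (rcons s a) = [~ comms b s, letter_val a].
Proof. by rewrite /comms -cats1 foldl_cat. Qed.

Lemma comms_H b s : (A `|` B) b.1 -> over s -> H (comms b s).
Proof.
move=> Db; elim/last_ind: s => [|s a IHs] As; first exact/(subgroup_letter sH)/H_AB.
rewrite comms_rcons; apply: subgroupR => //.
  by apply: IHs => p ps; apply: As; rewrite mem_rcons inE ps orbT.
by apply/(subgroup_letter sH)/H_A/As; rewrite mem_rcons mem_head.
Qed.

Lemma e_comms b s : (A `|` B) b.1 -> over s -> s <> [::] -> e (comms b s) = 0%R.
Proof.
move=> Db; elim/last_ind: s => // s a _ As _; rewrite comms_rcons.
apply: (additive_onR sH eD).
  by apply: comms_H => // p ps; apply: As; rewrite mem_rcons inE ps orbT.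
by apply/(subgroup_letter sH)/H_A/As; rewrite mem_rcons mem_head.
Qed.

Section Cocycle.
Variables (L : groupType) (Phi : G -> (G -> int) -> L).
Hypothesis PhiM : cocycle H e Phi.
Hypothesis Phi_tree : forall x q, A x -> low x q -> Phi x q = 1.

Lemma cocycle1 q : Phi 1 q = 1.
Proof.
have := PhiM sH.1 sH.1 q; rewrite mulg1 (additive_on1 sH eD) addr0.
by rewrite -{1}[Phi 1 q]mulg1 => /mulgI.
Qed.

Lemma cocycleV g q : H g -> Phi g^-1 q = (Phi g (q - e g)%R)^-1.
Proof.
move=> Hg; apply/esym/mulg1_eq.
by rewrite -{2}[q](subrK (e g)) -PhiM ?mulgV ?cocycle1//; apply: subgroupV.
Qed.

Lemma Phi_tree_letter a q : A a.1 -> low a.1 q -> Phi (letter_val a) q = 1.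
Proof.
move=> Aa lq; rewrite /letter_val; case: a.2; last exact: Phi_tree.
rewrite cocycleV; last exact: H_A.
rewrite Phi_tree ?invg1//; apply/lowD => //; apply/lowN.
have [[rfl _ _ _] _] := hle.
apply: (low_e (p := (a.1, false))) => //=; first by left.
by apply/rfl/mem_set; left.
Qed.

(** The label of the path [g] ending at [q]. Commutators with a letter involve this
    normalization at [q] itself and at one neighbour. *)
Definition shifted g q := Phi g (q - e g)%R.

(** Both letters [a] of the commutator run along tree edges, so a commutation
    with [a] acts on labels as a multiplicative difference operator. *)
Lemma shifted_comm u a q : H u -> A a.1 -> low a.1 q -> low a.1 (e u) ->
  shifted [~ u, letter_val a] q =
    (shifted u q)^-1 * shifted u (q - e (letter_val a))%R.
Proof.
move=> Hu Aa lq lu; have Ha : H (letter_val a) by apply/(subgroup_letter sH)/H_A.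
have [[Vu Va] Ma] : (H u^-1 /\ H (letter_val a)^-1) /\ H (u * letter_val a).
  by do ?split; [exact: subgroupV|exact: subgroupV|exact: subgroupM].
have Vau : H ((letter_val a)^-1 * (u * letter_val a)) by apply: subgroupM.
rewrite {1}/shifted (additive_onR sH eD)// subr0 commgEl conjgE.
rewrite !PhiM// cocycleV// !(additive_onV sH eD)//.
have [[rfl _ _ _] _] := hle.
have la : low a.1 (e (letter_val a)).
  by apply: low_e => //; [left|apply/rfl/mem_set; left].
have tree2 : Phi (letter_val a)^-1 (q - e u)%R = 1.
  rewrite -letter_flip; apply: Phi_tree_letter => //.
  by apply: lowD => //; apply: lowN.
rewrite tree2 mul1g [X in _ * (_ * X)]Phi_tree_letter//; last first.
  by do ?apply: lowD => //; apply: lowN.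
rewrite mulg1 /shifted; congr (_ * Phi u _).
by rewrite addrAC.
Qed.

Lemma shifted_comms_rcons b s a q : legal b (rcons s a) -> below b (rcons s a) ->
    low a.1 q ->
  shifted (comms b (rcons s a)) q =
    (shifted (comms b s) q)^-1 * shifted (comms b s) (q - e (letter_val a))%R.
Proof.
move=> [Db _ [As _ _] _] bs lq.
have Aa : A a.1 by apply: As; rewrite mem_rcons mem_head.
have {}As : over s by move=> p ps; apply: As; rewrite mem_rcons inE ps orbT.
rewrite comms_rcons shifted_comm//; first exact: comms_H.
case: s As bs => [|p s] As bs; last by rewrite e_comms.
by apply: low_e => //; case/andP: bs.
Qed.

Lemma shifted_tree b r : A b.1 -> over r -> (forall p, p \in r -> le b.1 p.1) ->
  shifted (letter_val b) (- disp r)%R = 1.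
Proof.
move=> Ab Ar br; rewrite /shifted; apply: Phi_tree_letter => //.
have [[rfl _ _ _] _] := hle.
apply: lowD; apply: lowN; first exact: low_disp.
by apply: low_e => //; [left|apply/rfl/mem_set; left].
Qed.

(** Read backwards, the difference equation recovers the label at [- disp (a :: r)]
    from two labels at [- disp r], hence all labels from those at the origin. *)
Lemma shifted_split b s a r : legal b (s ++ a :: r) -> below b (rcons s a) ->
  shifted (comms b s) (- disp (a :: r))%R =
    shifted (comms b s) (- disp r)%R * shifted (comms b (rcons s a)) (- disp r)%R.
Proof.
rewrite -cat_rcons => -[Db Bb nsr csr] bs.
have [ns _] := normal_cat nsr.
have := nsr; rewrite cat_rcons => /normal_cat[_ /normal_cons[Aa [Ar _ _] ar _]].
rewrite shifted_comms_rcons//.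
- rewrite mulVKg disp_cons; congr shifted.
  by rewrite opprD addrC.
- by split=> // p ps; apply: csr; rewrite mem_cat ps.
- exact/lowN/low_disp.
Qed.

Section Subgroup.
Variable N : set L.
Hypothesis sN : subgroup N.
Hypothesis N_base : forall v, (B `|` Uset le A B) v -> N (Phi v 0%R).

(** By induction on [r]: all labels are products of labels at the origin, and these
    are either trivial or labels of basis elements. *)
Lemma shifted_mem b s r : legal b (s ++ r) -> below b s ->
  N (shifted (comms b s) (- disp r)%R).
Proof.
elim: r s => [|a r IHr] s lsr bs.
  rewrite cats0 in lsr; rewrite disp_nil oppr0.
  case: s lsr bs => [|a s] ls bs; last first.
    have [Db _ [As _ _] _] := ls.
    rewrite /shifted e_comms// subr0; apply: N_base; right.
    by apply/Uset_comms; exists b, (a :: s).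
  have [[Ab|Bb] Bb' _ _] := ls.
    have -> : 0%R = (- disp [::])%R by rewrite disp_nil oppr0.
    by rewrite /= shifted_tree//; apply: sN.1.
  rewrite /shifted /comms /= /letter_val Bb'// eB// subr0.
  by apply: N_base; left.
have [Db _ nsr _] := lsr; have [_ nar] := normal_cat nsr.
have [Aa [Ar _ _] ar _] := (normal_cons a r).1 nar.
have [bsa|nbsa] := boolP (below b (rcons s a)).
  rewrite shifted_split//; apply: (subgroupM sN); first by apply: IHr => //; apply: legal_drop lsr.
  by apply: IHr => //; rewrite cat_rcons.
(* Here [s] is empty and no letter precedes [b]: the edge is in the tree. *)
case: s lsr bs nsr nbsa => [lsr _ _ /= nab|p s _ /= ps _ /negP//].
have [Ab|Bb] := Db; last first.
  by have [_ /(_ _ _ Aa Bb)] := hle; rewrite (negPf nab).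
rewrite [comms _ _]/= shifted_tree//; first exact: sN.1.
  exact/over_cons.
have ba : le b.1 a.1 by apply: order_leNgt => //; left.
move=> p; rewrite inE => /orP[/eqP->//|pr].
apply: (order_trans _ _ _ ba (ar _ pr)) => //; left => //; exact: Ar.
Qed.

Lemma Phi_mem g : H g -> forall q, lattice q -> N (Phi g q).
Proof.
move=> Hg; suff: (H `&` [set g | forall q, lattice q -> N (Phi g q)]) g by case.
apply: (free_basis_ind hX) Hg.
  split=> [|u v [Hu /= Nu] [Hv /= Nv]].
    by split=> [|q _]; [exact: sH.1|rewrite cocycle1; apply: sN.1].
  split=> [|q lq]; first exact: sH.2.
  have Vv := subgroupV sH Hv.
  rewrite PhiM// cocycleV//; apply: (subgroupM sN); first exact: Nu.
  apply: (subgroupV sN); apply: Nv.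
  by do ?apply: latticeD => //; [apply: lattice_e|apply/latticeN/lattice_e].
move=> x Dx; split=> [|q lq]; first exact: H_AB.
(* The edge [x] at [q] is the path [x] ending at [q + x] and the reverse of the path
   [x^-1] ending at [q]; the sign to use is the one for which the normal word of the
   end point is coherent with the letter. *)
have key c q' : (B x -> c = false) -> lattice q' ->
    (forall p, p \in nword (- q')%R -> p.1 = x -> p.2 = c) ->
    N (shifted (letter_val (x, c)) q').
  move=> Bx lq' cx; rewrite -[q']opprK -[X in (- X)%R]nword_disp; last exact: latticeN.
  apply: (@shifted_mem (x, c) [::]) => //; split=> //; exact: nword_normal.
case: (Dx) => [Ax|Bx]; last first.
  have := key false q (fun=> erefl) lq; rewrite /shifted /letter_val /= eB// subr0.
  apply=> p /[dup] pw; have [Ap _ _] := nword_normal (- q)%R.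
  by move=> /Ap Ap' E; have := A_notB Ap'; rewrite E.
have Bx c : B x -> c = false by move=> /(A_notB Ax).
have sgn q' p c : p \in nword (- q')%R -> lattice q' -> p.1 = x ->
    (if c then 0 <= q' x else q' x <= 0)%R -> p.2 = c.
  move=> pw lq' px; have := normal_sign (nword_normal _) pw.
  rewrite nword_disp ?px; last exact: latticeN.
  by rewrite oppE; case: p.2; case: c; lia.
have [qx|qx] := lerP 0%R (q x).
  have := key true q (@Bx _) lq.
  rewrite /shifted /letter_val /= (additive_onV sH eD (H_A Ax)) cocycleV; last exact: H_A.
  rewrite opprK addrK => Nx; rewrite -[Phi x q]invgK; apply: (subgroupV sN).
  by apply: Nx => p pw px; apply: (sgn q).
have lq' : lattice (q + e x)%R by apply: latticeD => //; apply/lattice_e/H_A.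
have := key false (q + e x)%R (@Bx _) lq'.
rewrite /shifted /letter_val /= addrK; apply=> p pw px.
by apply: (sgn (q + e x)%R) => //; rewrite addE eA// eqxx; lia.
Qed.

End Subgroup.
End Cocycle.

Lemma nword_ge x q p : A x -> low x q -> p \in nword q -> le x p.1.
Proof.
move=> Ax lq pq; have [Aq _ _] := nword_normal q.
apply: order_leNgt; [left; exact: Aq|by left|].
by apply/negP => px; apply: (nword_support pq); apply: lq => //; apply: Aq.
Qed.

(** * Generation *)

Section Generation.

(** The tree path from [0] to [q] starts with the largest letters: an edge of the tree
    may be traversed only as long as the lower coordinates vanish. *)
Definition transversal (q : G -> int) : G := \prod_(p <- rev (nword q)) letter_val p.

Lemma transversal_cons p r q : normal_word (p :: r) -> q = disp (p :: r) ->
  transversal q = transversal (disp r) * letter_val p.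
Proof.
move=> npr ->; have [_ nr _ _] := (normal_cons p r).1 npr.
by rewrite /transversal !disp_nwordK// rev_cons -cats1 big_cat big_seq1.
Qed.

(** Adding the letter [x] to a normal word whose letters are at least [x] either
    cancels the head or prepends [x]. *)
Lemma transversal_tree x q : A x -> low x q -> lattice q ->
  transversal q * x = transversal (q + e x)%R.
Proof.
move=> Ax lq Lq; have nr := nword_normal q; have Er := nword_disp Lq.
have [[r Exr]|nxr] := pselect (exists r, nword q = (x, true) :: r).
  rewrite Exr in nr Er; rewrite (transversal_cons nr (esym Er)).
  rewrite /letter_val /= mulgVK; congr transversal.
  rewrite -Er disp_cons e_letter; last by left.
  by rewrite [(- _ + _)%R]addrC subrK.
have nxr' : normal_word ((x, false) :: nword q).
  apply/normal_cons; split=> // p pq; first exact: nword_ge lq pq.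
  move=> /= px; apply/negbTE/negP => p2; apply: nxr.
  case: (nword q) pq nr (fun p => @nword_ge x q p Ax lq) => // h r pr nr xr.
  exists r; congr (_ :: _).
  have [_ _ cr] := nr; have [/= Ah [Ar _ _] hr _] := (normal_cons h r).1 nr.
  have Ehx : h.1 = x.
    apply: order_anti; [by left|by left| |by apply: xr; rewrite mem_head].
    move: pr; rewrite inE => /orP[/eqP<-|/hr]; rewrite px//.
    by have [[rfl _ _ _] _] := hle; apply/rfl/mem_set; left.
  have : h.2 = p.2 by apply: cr; rewrite ?mem_head// Ehx.
  by rewrite p2; case: h Ehx {Ah hr xr nr cr pr} => y c /= -> ->.
rewrite (transversal_cons nxr' (q := q + e x)%R) ?Er//.
by rewrite disp_cons Er addrC.
Qed.

(** The trivial value off the lattice makes the tree condition hold at every point. *)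
Definition schreier g q :=
  if `[< lattice q >] then transversal q * g / transversal (q + e g)%R else 1.

Lemma schreier_cocycle : cocycle H e schreier.
Proof.
move=> g h Hg Hh q; rewrite /schreier.
have -> : `[< lattice (q + e g)%R >] = `[< lattice q >].
  apply: asbool_equiv_eq; split=> [lqg|lq]; last exact/latticeD/lattice_e.
  rewrite -[q](addrK (e g)); apply: latticeD => //.
  exact/latticeN/lattice_e.
case: asboolP => _; last by rewrite mulg1.
by rewrite eD// addrA !mulgA mulgVK.
Qed.

Lemma schreier_tree x q : A x -> low x q -> schreier x q = 1.
Proof.
move=> Ax lq; rewrite /schreier; case: asboolP => // Lq.
by rewrite transversal_tree// mulgV.
Qed.

Lemma transversal0 : transversal 0%R = 1.
Proof.
by rewrite /transversal -disp_nil disp_nwordK// big_nil.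
Qed.

Lemma schreier_kernel g : e g = 0%R -> schreier g 0%R = g.
Proof.
move=> eg; rewrite /schreier eg addr0 transversal0 mul1g divg1.
by case: asboolP => // -[]; apply: lattice0.
Qed.

Lemma commutator_basis_kernel v : (B `|` Uset le A B) v -> H v /\ e v = 0%R.
Proof.
case=> [Bv|/Uset_comms[b [s [s0 [Db _ [As _ _] _] _ ->]]]].
  by split; [apply: H_B|apply: eB].
by split; [apply: comms_H|apply: e_comms].
Qed.

Lemma generated_commutator_basis :
  generated (B `|` Uset le A B) = H `&` [set g | e g = 0%R].
Proof.
apply/seteqP; split.
  apply: generated_min; first exact: additive_on_ker.
  exact: commutator_basis_kernel.
move=> g [Hg /= eg]; rewrite -(schreier_kernel eg).
apply: (Phi_mem schreier_cocycle schreier_tree) => //; last exact: lattice0.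
  exact: generated_subgroup.
move=> v Vv; have [_ ev] := commutator_basis_kernel Vv.
by rewrite schreier_kernel//; apply: sub_generated.
Qed.

End Generation.

(** * Freeness *)

Section Freeness.
Variables (L : groupType) (f : G -> L).

(** The prescribed label at the origin. It is trivial for the words that do not
    describe a basis element, as their edges lie in the tree. *)
Definition value b s : L :=
  if s is [::] then (if `[< B b.1 >] then f b.1 else 1)
  else if below b s then f (comms b s) else 1.

(** The solution of the difference equation of [shifted_split], that is, the label
    that [comms b s] must have when it ends at [- disp r]. *)
Fixpoint label b s r : L :=
  if r is a :: r' then label b s r' * label b (rcons s a) r' else value b s.

Lemma label_tree b s r : A b.1 -> (forall p, p \in s ++ r -> A p.1) ->
  (forall p, p \in s ++ r -> le b.1 p.1) -> label b s r = 1.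
Proof.
move=> Ab; elim: r s => [|a r IHr] s Asr bsr /=.
  rewrite cats0 in Asr bsr; case: s Asr bsr => [|p s] Asr bsr /=.
    by case: asboolP => // /(A_notB Ab).
  case: ifP => // pb; have Ap : A p.1 by apply: Asr; rewrite mem_head.
  have := order_ltNge (or_introl Ap) (or_introl Ab) pb.
  by rewrite bsr ?mem_head.
rewrite !IHr ?mulg1// => p; rewrite ?cat_rcons; [exact: Asr|exact: bsr| |];
  rewrite mem_cat => /orP[ps|pr]; [apply: Asr|apply: Asr|apply: bsr|apply: bsr];
  by rewrite mem_cat inE ?ps ?pr ?orbT.
Qed.

(** For [x] in [A], the edge from [q] to [q + x] is labelled as the path [x] ending at
    [q + x] on the negative side, and as the reverse of the path [x^-1] ending at [q]
    on the other. *)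
Definition edge x (q : G -> int) : L :=
  if `[< B x >] then label (x, false) [::] (nword (- q)%R)
  else if (0 <= q x)%R then (label (x, true) [::] (nword (- q)%R))^-1
  else label (x, false) [::] (nword (- (q + e x))%R).

Lemma edge_tree x q : A x -> low x q -> edge x q = 1.
Proof.
move=> Ax lq; rewrite /edge; case: asboolP => [/(A_notB Ax)//|_].
have lx : low x (e x).
  have [[rfl _ _ _] _] := hle.
  by apply: (low_e (p := (x, false))) => //=; [left|apply/rfl/mem_set; left].
have tree c q' : low x q' -> label (x, c) [::] (nword q') = 1.
  move=> lq'; apply: label_tree => //= p pq.
    by have [Aq _ _] := nword_normal q'; apply: Aq.
  exact: nword_ge lq' pq.
by case: ifP => _; rewrite tree ?invg1//; apply/lowN => //; apply: lowD.
Qed.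

Variable Phi : G -> (G -> int) -> L.
Hypothesis PhiM : cocycle H e Phi.
Hypothesis Phi_edge : forall x, (A `|` B) x -> Phi x = edge x.

Let Phi_tree x q : A x -> low x q -> Phi x q = 1.
Proof. by move=> Ax lq; rewrite Phi_edge; [apply: edge_tree|left]. Qed.

Lemma shifted_letter b r : legal b r ->
  shifted Phi (letter_val b) (- disp r)%R = label b [::] r.
Proof.
move=> [Db Bb nr cbr]; have [Ar _ _] := nr.
case: b Db Bb cbr => x c /= Dx Bx cxr; rewrite /shifted.
have sgn : if c then (disp r x <= 0)%R else (0 <= disp r x)%R.
  have [[p [pr px]]|nx] := pselect (exists p, p \in r /\ p.1 = x).
    by have := normal_sign nr pr; rewrite (cxr p)// px; case: (c); lia.
  rewrite (@disp_notin r x)//; first by case: (c).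
  by move=> p pr px; apply: nx; exists p.
case: (Dx) => [Ax|Bx']; last first.
  have /= -> := Bx Bx'; rewrite /letter_val /= eB// subr0 Phi_edge// /edge.
  by rewrite opprK disp_nwordK//; case: asboolP.
have nBx : `[< B x >] = false by apply/negbTE/asboolPn/A_notB.
case: c sgn {Bx cxr} => sgn; rewrite /letter_val /=.
  rewrite (additive_onV sH eD (H_A Ax)) (cocycleV PhiM _ (H_A Ax)) opprK addrK.
  rewrite Phi_edge// /edge nBx oppE oppr_ge0 sgn invgK opprK.
  by rewrite disp_nwordK.
rewrite Phi_edge// /edge nBx addE !oppE eA// eqxx.
case: ifP => [|_]; first by lia.
by rewrite -eA// subrK opprK disp_nwordK.
Qed.

Lemma shifted_label b s r : legal b (s ++ r) -> below b s ->
  shifted Phi (comms b s) (- disp r)%R = label b s r.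
Proof.
elim/last_ind: s r => [|s a IHs] r lsr bsa; first exact: shifted_letter.
have bs : below b s by case: s bsa {IHs lsr}.
rewrite cat_rcons in lsr.
have := shifted_split PhiM Phi_tree lsr bsa.
rewrite (IHs (a :: r))// (IHs r)//=; last exact: legal_drop lsr.
by move=> /mulgI.
Qed.

Lemma Phi_basis v : (B `|` Uset le A B) v -> Phi v 0%R = f v.
Proof.
have at0 b s : legal b s -> below b s -> e (comms b s) = 0%R ->
    Phi (comms b s) 0%R = value b s.
  move=> ls bs es; have := @shifted_label b s [::].
  by rewrite cats0 /shifted es disp_nil oppr0 subr0; apply.
case=> [Bv|/Uset_comms[b [s [s0 ls bs ->]]]].
  rewrite (at0 (v, false) [::])//; last by rewrite /comms /letter_val /= eB.
    by rewrite /= asboolT.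
  by split=> //; right.
have [Db _ [As _ _] _] := ls.
by rewrite at0 ?e_comms// /value; case: s s0 bs {ls As} => // a s _ /= ->.
Qed.

End Freeness.

(** A word over the basis has at the origin the label of the same word over the values
    of [f]; these being free letters, a reduced word is not trivial. *)
Theorem commutator_free_basis :
  free_basis (B `|` Uset le A B) (H `&` [set g | e g = 0%R]).
Proof.
split=> [|s Vs s_neq0 rs s1]; first exact: generated_commutator_basis.
pose f := @letter_perm G.
have [e' [Phi [eD' PhiM' eX PhiX]]] := free_basis_cocycle e (edge f) hX.
have ee' : {in H, e' =1 e}.
  by apply: (additive_on_ext hX eD' eD) => x /set_mem; apply: eX.
have PhiM : cocycle H e Phi.
  by move=> g h Hg Hh q; rewrite PhiM'// ee'//; apply/mem_set.
have PhiV := Phi_basis PhiM PhiX.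
apply: (letter_perm_free s_neq0 rs).
have Phi1 := cocycle1 PhiM 0%R; rewrite -{1}s1 in Phi1; rewrite -[RHS]Phi1 => {Phi1}.
have : H (\prod_(p <- s) letter_val p) /\
       e (\prod_(p <- s) letter_val p) = 0%R /\
       \prod_(p <- s) letter_val (f p.1, p.2) =
         Phi (\prod_(p <- s) letter_val p) 0%R; last by case=> _ [].
elim: s Vs {s_neq0 rs s1} => [|p s IHs] Vs.
  by rewrite !big_nil (cocycle1 PhiM) (additive_on1 sH eD); split; first by apply: sH.1.
have [|Hs [es Phis]] := IHs.
  by move=> q qs; apply: Vs; rewrite inE qs orbT.
have Vp : (B `|` Uset le A B) p.1 by apply: Vs; rewrite mem_head.
have [Hp ep] := commutator_basis_kernel Vp.
have Hl := subgroup_letter sH Hp.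
have el : e (letter_val p) = 0%R.
  by rewrite /letter_val; case: p.2; rewrite ?(additive_onV sH)// ep oppr0.
rewrite !big_cons; split; first exact: subgroupM.
rewrite eD// el es addr0; split=> //; rewrite PhiM// el addr0 -Phis.
congr (_ * _); rewrite -PhiV// /letter_val /=; case: p.2 => //.
by rewrite (cocycleV PhiM)// ep subr0.
Qed.

End CommutatorBasis.

(** * Derived groups and exponents *)

Lemma Uset_derived (G : groupType) (A B H : set G) (le : rel G) :
  subgroup H -> A `|` B `<=` H -> Uset le A B `<=` derived H.
Proof.
move=> sH DH _ [b [a [s [Db As _ _ [_ _ ->]]]]].
have letterA p : p \in a :: s -> H (letter_val p).
  by move=> /As Ap; apply/(subgroup_letter sH)/DH; left.
have Hb := subgroup_letter sH (DH _ Db).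
have : derived H [~ letter_val b, letter_val a].
  by apply: derivedR => //; apply: letterA; rewrite mem_head.
have {}letterA p : p \in s -> H (letter_val p).
  by move=> ps; apply: letterA; rewrite inE ps orbT.
rewrite /=; move: [~ _, _]; elim: s letterA {As} => //= p s IHs letterA u Du.
apply: IHs => [q qs|]; first by apply: letterA; rewrite inE qs orbT.
by apply: derivedR; [apply: derived_sub|apply: letterA; rewrite mem_head].
Qed.

Lemma additive_on_derived (G : groupType) (P : zmodType) (H : set G) (e : G -> P) g :
  subgroup H -> additive_on H e -> derived H g -> e g = 0%R.
Proof.
move=> sH eD Dg; suff: (H `&` [set g | e g = 0%R]) g by case.
apply: generated_min Dg; first exact: (additive_on_ker sH eD).
move=> _ [u [v [Hu Hv ->]]]; split; first exact: subgroupR.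
exact: (additive_onR sH eD).
Qed.

(** The commutators furnished by [commutator_free_basis] with [B] empty lie in the
    derived group, so the latter contains every element without exponents. *)
Lemma derived_free_basis (G : groupType) (X H : set G) (le : rel G)
    (e : G -> G -> int) :
    free_basis X H -> total_order_on X le -> additive_on H e ->
    (forall x, X x -> e x = fun z => Posz (z == x)) ->
  derived H = H `&` [set g | e g = 0%R].
Proof.
move=> hX hle eD eX; have sH := free_basis_subgroup hX.
apply/seteqP; split=> [g Dg|].
  split; [exact: derived_sub Dg|exact: additive_on_derived Dg].
have hX0 : free_basis (X `|` set0) H by rewrite setU0.
have hle0 : U_order X set0 le by split; [rewrite setU0|].
have [<- _] := commutator_free_basis hX0 hle0 eD eX (fun _ => @False_ind _).
rewrite set0U; apply: generated_min; first exact: generated_subgroup.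
by apply: Uset_derived => //; apply: free_basis_sub.
Qed.

Lemma free_basis_exponents (G : groupType) (X H : set G) : free_basis X H ->
  exists2 e : G -> G -> int, additive_on H e
    & forall x, X x -> e x = fun z => Posz (z == x).
Proof.
move=> hX; have [e [_ [eD _ eX _]]] :=
  free_basis_cocycle (fun y z => Posz (z == y)) (fun _ _ => 1 : G) hX.
by exists e.
Qed.

Lemma additive_zpow (G : groupType) (e : G -> G -> int) (x z : G) (k : int) :
  additive_on [set: G] e -> e (zpow x k) z = (e x z * k)%R.
Proof.
move=> eD; have sT : subgroup [set: G] by [].
have eX m : e (x ^+ m) z = (e x z * Posz m)%R.
  elim: m => [|m IHm]; first by rewrite expg0 (additive_on1 sT eD) mulr0.
  rewrite expgS eD// -[LHS]/(e x z + e (x ^+ m)%g z)%R IHm.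
  by rewrite -[in RHS]addn1 PoszD mulrDr mulr1 addrC.
case: k => m /=; first exact: eX.
rewrite (additive_onV sT eD)// -[LHS]/(- e (x ^+ m.+1)%g z)%R eX.
by rewrite NegzE mulrN.
Qed.

Definition restrict (G : groupType) (D : set G) (e : G -> G -> int) :=
  fun g z => if `[< D z >] then e g z else 0%R.

Lemma additive_restrict (G : groupType) (D H : set G) (e : G -> G -> int) :
  additive_on H e -> additive_on H (restrict D e).
Proof.
move=> eD g h Hg Hh; apply/funext => z; rewrite /restrict eD//.
by rewrite -[RHS]/((if _ then _ else _) + (if _ then _ else _))%R; case: asboolP.
Qed.

Lemma restrict_in (G : groupType) (D : set G) (e : G -> G -> int) x :
  e x = (fun z => Posz (z == x)) -> D x -> restrict D e x = fun z => Posz (z == x).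
Proof.
move=> ex Dx; apply/funext => z; rewrite /restrict ex.
by case: asboolP => // nDz; case: eqP => // E; case: nDz; rewrite E.
Qed.

Lemma restrict_out (G : groupType) (D : set G) (e : G -> G -> int) x :
  e x = (fun z => Posz (z == x)) -> ~ D x -> restrict D e x = 0%R.
Proof.
move=> ex nDx; apply/funext => z; rewrite /restrict ex.
by case: asboolP => // Dz; case: eqP => // E; case: nDx; rewrite -E.
Qed.

Lemma restrict_eq0 (G : groupType) (D : set G) (e : G -> G -> int) g :
  restrict D e g = 0%R <-> forall z, D z -> e g z = 0%R.
Proof.
rewrite /restrict; split=> [E z Dz|E].
  by have := congr1 (fun q => q z) E; rewrite asboolT.
by apply/funext => z; case: asboolP => [/E|].
Qed.

Theorem theorem2p7 (F : groupType) (n : nat) (x : 'I_n -> F)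
  (R : set F) (N : option nat) (w : nat -> F) (t : nat) (alpha : 'I_n -> int)
  (hx : free_basis_family [set: 'I_n] x [set: F])
  (hR : normal_subgroup R)
  (hRfin : exists2 S : set F, finite_set S & R = normal_closure S)
  (hw : free_basis_family (seq_index N) w R)
  (htn : (t <= n)%N) (htN : `I_t `<=` seq_index N)
  (halpha : forall i : 'I_n, (i < t)%N -> alpha i <> Posz 0)
  (hw1 : forall i : 'I_n, (i < t)%N ->
     derived [set: F] ((zpow (x i) (alpha i))^-1 * w i))
  (hw2 : forall j : nat, seq_index N j -> (t <= j)%N ->
     derived [set: F] (w j)) :
  let W1 := w @` `I_t in
  let W2 := w @` [set j | seq_index N j /\ (t <= j)%N] in
  forall le1 : rel F, U_order W1 W2 le1 ->
  let U1 := Uset le1 W1 W2 in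
  free_basis (W2 `|` U1) (R `&` derived [set: F]) /\
  forall le2 : rel F, U_order W2 U1 le2 ->
  free_basis (U1 `|` Uset le2 W2 U1) (derived R).
Proof.
move=> W1 W2 le1 hle1 U1.
have sT : subgroup [set: F] by [].
have [x_inj hxF] := hx; have [w_inj hwR] := hw.
have defW : w @` seq_index N = W1 `|` W2.
  apply/seteqP; split=> [_ [j Nj <-]|_ [[j jt <-]|[j [Nj tj] <-]]].
  - by case: (ltnP j t) => jt; [left|right]; exists j.
  - by exists j => //; apply: htN.
  - by exists j.
rewrite defW in hwR.
have sR := free_basis_subgroup hwR; have WR := free_basis_sub hwR.
have disjW g : W1 g -> ~ W2 g.
  by move=> g1 g2; have [_ /(_ g g g1 g2)/andP[_ /eqP]] := hle1.
have [eF eFD eFx] := free_basis_exponents hxF.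
have [e eD eW] := free_basis_exponents hwR.
have basis1 : free_basis (W2 `|` U1) (R `&` [set g | restrict W1 e g = 0%R]).
  apply: commutator_free_basis => //; first exact: additive_restrict.
    by move=> y y1; apply: restrict_in => //; apply: eW; left.
  move=> y y2; apply: restrict_out; first by apply: eW; right.
  by move=> /disjW.
(* The exponents of [g] in [w_i] and in [x_i] differ by the nonzero factor
   [alpha i]. *)
have derT_exponent (i : 'I_n) g : (i < t)%N -> R g -> derived [set: F] g ->
    e g (w i) = 0%R.
  move=> it Rg Dg.
  have eFw (j : nat) : (W1 `|` W2) (w j) -> seq_index N j ->
      eF (w j) (x i) = (e (w j) (w i) * alpha i)%R.
    move=> Wj Nj; rewrite (eW _ Wj).
    have -> : (w i == w j) = (i == j :> nat).
      apply/eqP/eqP => [|->//]; apply: w_inj; apply/mem_set => //.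
      exact: htN.
    case: (ltnP j t) => [jt|tj]; last first.
      rewrite (additive_on_derived sT eFD (hw2 _ Nj tj)).
      by case: eqP => [Eij|]; [move: it tj; rewrite Eij ltnNge => /negP|rewrite mul0r].
    have jn := leq_trans jt htn; pose j' := Ordinal jn.
    have -> : w j = zpow (x j') (alpha j') * ((zpow (x j') (alpha j'))^-1 * w j').
      by rewrite mulVKg.
    rewrite eFD// (additive_on_derived sT eFD (hw1 j' jt)) addr0 additive_zpow//.
    rewrite (eFx (x j')); last by exists j'.
    have -> : (x i == x j') = (i == j :> nat).
      apply/eqP/eqP => [xij|ij]; last by congr x; apply: val_inj.
      by have -> : i = j' by apply: x_inj => //; apply/mem_set.
    by case: eqP => [ij|]; [congr (_ * alpha _)%R; apply: val_inj|rewrite !mul0r].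
  have eFR : additive_on R (fun g => eF g (x i)).
    by move=> g1 g2 _ _; rewrite eFD.
  have eR : additive_on R (fun g => (e g (w i) * alpha i)%R).
    by move=> g1 g2 Rg1 Rg2; rewrite eD// -mulrDl.
  have agree : {in W1 `|` W2, (fun g => eF g (x i)) =1
                              (fun g => (e g (w i) * alpha i)%R)}.
    by move=> y /set_mem Wy; move: (Wy); rewrite -defW => -[j Nj Ej];
      rewrite -Ej eFw// Ej.
  have := additive_on_ext hwR eFR eR agree (mem_set Rg).
  rewrite (additive_on_derived sT eFD Dg) => /esym/eqP.
  by rewrite mulf_eq0 (negPf (introN eqP (halpha i it))) orbF => /eqP.
have W1_derT : R `&` [set g | restrict W1 e g = 0%R] = R `&` derived [set: F].
  apply/seteqP; split=> [g Rg|g [Rg Dg]].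
    split; first by case: Rg.
    move: g Rg; case: basis1 => <- _; apply: generated_min.
      exact: generated_subgroup.
    move=> y [[j [Nj tj] <-]|/(Uset_derived sR WR)]; first exact: hw2.
    exact: derivedS.
  split=> //; apply/restrict_eq0 => _ [i it <-].
  have iN := leq_trans it htn.
  exact: (derT_exponent (Ordinal iN)).
rewrite W1_derT in basis1; split=> // le2 hle2.
have sR1 := free_basis_subgroup basis1.
suff -> : derived R = (R `&` derived [set: F]) `&` [set g | restrict W2 e g = 0%R].
  apply: commutator_free_basis => //.
  - by move=> g h [Rg _] [Rh _]; apply: (additive_restrict W2 eD).
  - by move=> y y2; apply: restrict_in => //; apply: eW; right.
  - move=> y /(Uset_derived sR WR) Dy; apply/restrict_eq0 => z _.
    by rewrite (additive_on_derived sR eD Dy).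
rewrite (derived_free_basis hwR hle1.1 (additive_restrict (W1 `|` W2) eD)); last first.
  by move=> y Wy; apply: restrict_in => //; apply: eW.
rewrite -W1_derT; apply/seteqP; split=> g /=; rewrite !restrict_eq0.
  by move=> [Rg eg]; do ?split=> //; move=> z Wz; apply: eg; [left|right].
by move=> [[Rg e1] e2]; split=> // z [/e1|/e2].
Qed.
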